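(* Let $\mathbb{K}$ be an algebraically closed field, let $V$ be a vector space over $\mathbb{K}$ with finite positive dimension, and let $A,A^*$ be a tridiagonal pair on $V$ with diameter $d$ and shape $\{\rho_i\}_{i=0}^d$. Then $$\rho_i \leq \binom{d}{i}\qquad (0\leq i\leq d).$$
   Context: Let $\mathbb{K}$ be a field and $V$ a vector space over $\mathbb{K}$ with finite positive dimension. For a linear transformation $A:V\to V$, an eigenspace of $A$ is a nonzero subspace of the form $\{v\in V\mid Av=\theta v\}$ with $\theta\in\mathbb{K}$; $A$ is diagonalizable if $V$ is spanned by the eigenspaces of $A$. A tridiagonal pair on $V$ is an ordered pair of linear transformations $A:V\to V$, $A^*:V\to V$ such that: (i) each of $A,A^*$ is diagonalizable; (ii) there is an ordering $\{V_i\}_{i=0}^d$ of the eigenspaces of $A$ with $A^*V_i\subseteq V_{i-1}+V_i+V_{i+1}$ for $0\leq i\leq d$, where $V_{-1}=0$, $V_{d+1}=0$; (iii) there is an ordering $\{V^*_i\}_{i=0}^\delta$ of the eigenspaces of $A^*$ with $AV^*_i\subseteq V^*_{i-1}+V^*_i+V^*_{i+1}$ for $0\leq i\leq\delta$, where $V^*_{-1}=0$, $V^*_{\delta+1}=0$; (iv) there is no subspace $W$ of $V$ with $AW\subseteq W$, $A^*W\subseteq W$, $W\neq 0$, $W\neq V$. (Here $A^*$ is just a name; it does not denote a conjugate-transpose.) An ordering of the eigenspaces of $A$ (resp. $A^*$) as in (ii) (resp. (iii)) is called standard. It is known that $d=\delta$ (called the diameter), that if $\{V_i\}_{i=0}^d$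 is standard then the only other standard ordering is $\{V_{d-i}\}_{i=0}^d$ (similarly for $A^*$), and that for $0\leq i\leq d$ and any standard orderings the spaces $V_i,V^*_i,V_{d-i},V^*_{d-i}$ have the same dimension; this common dimension is denoted $\rho_i$. The sequence $\{\rho_i\}_{i=0}^d$ is called the shape of $A,A^*$. It is also known from earlier work that $\rho_0=1$ when $\mathbb{K}$ is algebraically closed. *)

(* Defs.v *)
From HB Require Import structures.
From mathcomp Require Import all_boot all_algebra.

Set Implicit Arguments.
Unset Strict Implicit.
Unset Printing Implicit Defensive.

Import GRing.Theory.
Local Open Scope ring_scope.

Section TridiagonalPair.

Variables (K : fieldType) (vT : vectType K).
Implicit Types (A B : 'End(vT)) (U W : {vspace vT}) (Vs : seq {vspace vT}).

Definition is_eigenspace A U : Prop :=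
  U <> 0%VS /\ exists theta : K, U = passmx.leigenspace A theta.

(* The span of the eigenspaces is the least subspace containing all of them.  *)
Definition diagonalizable_end A : Prop :=
  forall W, (forall U, is_eigenspace A U -> (U <= W)%VS) -> W = fullv.

Definition eigenspace_ordering A Vs : Prop :=
  uniq Vs /\ forall U, U \in Vs <-> is_eigenspace A U.

(* prev_space Vs i and nth 0%VS Vs i.+1 are V_{i-1} and V_{i+1}, with the     *)
(* conventions V_{-1} = 0 and V_{d+1} = 0, where size Vs = d.+1.              *)
Definition prev_space Vs (i : nat) : {vspace vT} :=
  if i is j.+1 then nth 0%VS Vs j else 0%VS.

Definition standard_ordering A B Vs : Prop :=
  eigenspace_ordering A Vs /\
  forall i : nat, (i < size Vs)%N ->
    (B @: nth 0%VS Vs i <=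
       prev_space Vs i + nth 0%VS Vs i + nth 0%VS Vs i.+1)%VS.

(* B is the transformation usually written A^*.                               *)
Definition tridiagonal_pair A B : Prop :=
  [/\ diagonalizable_end A /\ diagonalizable_end B,
      exists Vs, standard_ordering A B Vs,
      exists Vs, standard_ordering B A Vs
    & ~ exists W, [/\ (A @: W <= W)%VS, (B @: W <= W)%VS,
                      W <> 0%VS & W <> fullv]].

Definition has_diameter A B (d : nat) : Prop :=
  exists2 Vs, standard_ordering A B Vs & size Vs = d.+1.

(* The dimensions are read off some standard ordering of the eigenspaces of A;
   for a tridiagonal pair every standard ordering, of the eigenspaces of A or
   of B, gives the same sequence (a theorem).  Asking for one ordering only
   keeps that theorem out of the hypothesis has_shape. *)
Definition has_shape A B (rho : seq nat) : Prop :=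
  exists2 Vs, standard_ordering A B Vs & rho = [seq \dim U | U <- Vs].

End TridiagonalPair.

(* Main.v *)
Require Import Defs.
From HB Require Import structures.
From mathcomp Require Import all_boot all_algebra zify.

(** Let E_0, ..., E_d and F_0, ..., F_d be the primitive idempotents of the two
    members of a tridiagonal pair, in standard order.  Apart from
    irreducibility, the only input is the relations F_i A^q F_j = 0 for
    q < |i - j|, where A is the member with idempotents E, and the same with the
    two members exchanged.  Since A^q is a combination of the E_a with
    Vandermonde coefficients, they allow any |i - j| of the products
    F_i E_a F_j to be eliminated in favour of the others.

    By linear elimination in triangular arrays of such products
    (staircase_elim), first the operators F_0 E_a F_0 commute
    (commuting_corner), so that over an algebraically closed field they have a
    common eigenvector v in the image of F_0.  By irreducibility, v generates
    the whole space under words in the E_a and F_j.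

    Second, every word applied to v reduces to spiral words, in which the
    successive indices 0 = b_0, a_1, b_1, a_2, ... satisfy
    b_0 < b_1 < ... and a_1 > a_2 > ..., every b being at most every a.
    A letter that does not shrink the current interval can be traded for words
    whose first deviation is wider, or for shorter ones (spiral_step).  The
    reduction is organized as an induction on the width of the interval
    (spiral_span), using that reversing the orders and exchanging the members
    turns the state after a letter into a state of the same kind.

    The spiral words that end in F_i thus span the image of F_i.  There are
    binomial(d, i) of them: choosing which indices below i and above it occur
    gives a Vandermonde sum, computed here by recursion on the width
    (spiral_count_rec).  The equality of the two numbers of eigenspaces
    comes from the split decomposition (diameter_le). *)

Set Implicit Arguments.
Unset Strict Implicit.
Unset Printing Implicit Defensive.

Import GRing.Theory.
Local Open Scope ring_scope.

(** * Arrays whose rows and columns have vanishing moments *)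
Section Elimination.

Variables (K : fieldType) (vT : vectType K) (d : nat).
Implicit Types (N : {vspace vT}) (th : nat -> K).

Definition distinct_upto th := {in [pred i | (i <= d)%N] &, injective th}.

(** Vandermonde elimination modulo a subspace: when at most r of the vectors
    z a are unknown and r moments are known, every z a is known.  For an
    unknown index c, sum p(th a) z a for the polynomial p whose roots are the
    th b with b unknown and distinct from c; its degree is less than r, so the
    sum lies in N, and only the c term of it is not already in N. *)
Lemma moment_elim th (z : nat -> vT) N lo hi r :
    distinct_upto th -> (hi <= d.+1)%N -> (hi - lo <= r)%N ->
    (forall a, (a <= d)%N -> ~~ (lo <= a < hi)%N -> z a \in N) ->
    (forall q, (q < r)%N -> \sum_(a < d.+1) th a ^+ q *: z a \in N) ->
  forall a, (a <= d)%N -> z a \in N.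
Proof.
move=> th_inj hid hir zN momN c cd.
have [c_in | ] := boolP (lo <= c < hi)%N; last exact: zN.
pose p := \prod_(b <- rem c (index_iota lo hi)) ('X - (th b)%:P).
have sz_p : (size p <= r)%N.
  rewrite size_prod_XsubC size_rem ?mem_index_iota // size_iota.
  by move: hir c_in; lia.
have memN : \sum_(a < d.+1) p.[th a] *: z a \in N.
  rewrite (eq_bigr (fun a : 'I_d.+1 =>
             \sum_(q < size p) p`_q *: (th a ^+ q *: z a))); last first.
    move=> a _; rewrite horner_coef scaler_suml.
    by apply: eq_bigr => q _; rewrite scalerA.
  rewrite exchange_big /=; apply: memv_suml => q _.
  rewrite -scaler_sumr memvZ // momN //.
  exact: leq_trans (ltn_ord q) sz_p.
have p_root b : (lo <= b < hi)%N -> b != c -> p.[th b] = 0.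
  move=> b_in b_ne; apply/eqP; rewrite horner_prod prodf_seq_eq0.
  apply/hasP; exists b; last by rewrite hornerXsubC subrr /=.
  by rewrite mem_rem_uniq ?iota_uniq // inE b_ne mem_index_iota.
have p_nroot : p.[th c] != 0.
  rewrite horner_prod prodf_seq_neq0; apply/allP => b.
  rewrite mem_rem_uniq ?iota_uniq // inE mem_index_iota => /andP[b_ne b_in].
  rewrite /= hornerXsubC subr_eq0; apply: contra b_ne => /eqP eq_th.
  by apply/eqP; symmetry; apply: th_inj => //; rewrite inE; move: b_in; lia.
have c_lt : (c < d.+1)%N by [].
have := memN; rewrite (bigD1 (Ordinal c_lt)) //= rpredDr.
  by rewrite rpredZeq (negPf p_nroot).
apply: memv_suml => a a_ne; have [a_in | a_out] := boolP (lo <= a < hi)%N.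
  by rewrite p_root // scale0r mem0v.
by rewrite memvZ // zN // -ltnS.
Qed.

(** An array supported on a block of n + e rows and n columns vanishes modulo
    N when its s-th row has n - s vanishing moments and its t-th column has
    t + e.  The first row has as many moments as unknowns, so it vanishes; that
    leaves n + e - 1 unknowns in the last column, exactly the number of its
    moments.  Removing both leaves a staircase of size n - 1.  The case e = 0
    gives the commutativity of the corner, and e = 1 the spiral step. *)
Lemma staircase_elim th ts (z : nat -> nat -> vT) N r c n e :
    distinct_upto th -> distinct_upto ts ->
    (r + n + e <= d.+1)%N -> (c + n <= d.+1)%N ->
    (forall s t, (s <= d)%N -> (t <= d)%N ->
       ~~ ((r <= s < r + n + e) && (c <= t < c + n))%N -> z s t \in N) ->
    (forall s q, (s < n)%N -> (q < n - s)%N ->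
       \sum_(t < d.+1) ts t ^+ q *: z (r + s)%N t \in N) ->
    (forall t q, (t < n)%N -> (q < t + e)%N ->
       \sum_(s < d.+1) th s ^+ q *: z s (c + t)%N \in N) ->
  forall s t, (s <= d)%N -> (t <= d)%N -> z s t \in N.
Proof.
move=> th_inj ts_inj rd cd zN rowN colN.
(* The first k rows and the last k columns have been removed. *)
have peel k : (k <= n)%N -> forall s t, (s <= d)%N -> (t <= d)%N ->
    (s < r + k)%N || (c + n - k <= t)%N -> z s t \in N.
  elim: k => [_|k IHk kn] s t sd td st.
    by apply: zN => //; move: st; lia.
  have old := IHk (ltnW kn).
  have rowk j : (j <= d)%N -> z (r + k)%N j \in N.
    move: j; apply: (@moment_elim ts _ N c (c + n - k) (n - k)) => //; try lia.
    - move=> j jd; have [jlt | jge] := ltnP j (c + n - k).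
        by move=> ?; apply: zN => //; lia.
      by move=> _; apply: old => //; lia.
    - by move=> q; apply: rowN.
  have colk i : (i <= d)%N -> z i (c + (n - k.+1))%N \in N.
    move: i; apply: (@moment_elim th (fun i => z i (c + (n - k.+1))%N) N
                       (r + k.+1) (r + n + e) (n - k.+1 + e)) => //; try lia.
    - move=> i id; have [ik | ] := boolP (i == r + k)%N.
        by rewrite (eqP ik) rowk //; lia.
      have [ilt | ige] := ltnP i (r + k).
        by move=> _ _; apply: old => //; lia.
      by move=> ? ?; apply: zN => //; lia.
    - by move=> q; apply: colN; lia.
  have [sk | ] := boolP (s == r + k)%N; first by rewrite (eqP sk) rowk.
  have [tk | ] := boolP (t == c + (n - k.+1))%N; first by rewrite (eqP tk) colk.
  by move=> ? ?; apply: old => //; lia.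
move=> s t sd td; have [sn | sn] := boolP ((s < r + n) || (c + n - n <= t))%N.
  exact: (peel n).
by apply: zN => //; move: sn; lia.
Qed.

End Elimination.

(** * Counting strictly nested words *)

(** A word that starts in a state of width m and strictly shrinks the interval
    at each letter amounts to a strictly decreasing sequence m > t1 > t2 > ...
    of widths.  The value is the number of such words of the given parity of
    length that end at distance p from the base of the interval. *)
Definition spiral_count (odd_len : bool) (m p : nat) : nat :=
  if m is m'.+1 then 'C(m', p) else (~~ odd_len && (p == 0)).

(** The first letter shrinks the width from m to some t and reverses the
    direction in which distances are measured, so that the end point at distance
    p from the old base is at distance t - p from the new one.  Summing over t
    is the hockey-stick identity. *)
Lemma spiral_count_rec o m p :
  spiral_count o m p =
    ((~~ o && (p == 0)) +
     \sum_(t < m) if p <= t then spiral_count (~~ o) t (t - p) else 0)%N.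
Proof.
case: m => [|m]; first by rewrite big_ord0 addn0.
rewrite /spiral_count; elim: m => [|m IHm].
  by rewrite big_ord1 /= bin0n; case: p => [|p]; case: o.
rewrite big_ord_recr /= addnA -IHm; case: p {IHm} => [|p].
  by rewrite !bin0 subn0 bin_small.
by rewrite binS subSS; case: leqP => pm; rewrite ?(bin_small pm) ?bin_sub.
Qed.

(** * Words in two families of idempotents *)
Section Words.

Variables (K : fieldType) (vT : vectType K).
Implicit Types (E F : nat -> 'End(vT)) (th ts : nat -> K).
Implicit Types (N : nat -> {vspace vT}) (U W : {vspace vT}).

(** The properties of the primitive idempotents E of one member of a
    tridiagonal pair and F of the other, with eigenvalues th and ts, that the
    bound depends on.  The last two say that F_i A^q F_j = 0, respectively
    E_i B^q E_j = 0, for q < |i - j|, the powers being expanded over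
    eigenvalues. *)
Record td_system d E F th ts : Prop := TdSystem {
  td_inj : distinct_upto d th;
  td_injs : distinct_upto d ts;
  td_orth : forall a b x, (a <= d)%N -> (b <= d)%N ->
    E a (E b x) = if a == b then E b x else 0;
  td_orths : forall a b x, (a <= d)%N -> (b <= d)%N ->
    F a (F b x) = if a == b then F b x else 0;
  td_sum : forall x, \sum_(a < d.+1) E a x = x;
  td_sums : forall x, \sum_(a < d.+1) F a x = x;
  td_rel : forall i j q x, (i <= d)%N -> (j <= d)%N ->
    (q < (i - j) + (j - i))%N ->
    \sum_(a < d.+1) th a ^+ q *: F i (E a (F j x)) = 0;
  td_rels : forall i j q x, (i <= d)%N -> (j <= d)%N ->
    (q < (i - j) + (j - i))%N ->
    \sum_(a < d.+1) ts a ^+ q *: E i (F a (E j x)) = 0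
}.

Definition flip (T : Type) d (E : nat -> T) i := E (d - i)%N.

Lemma sum_flip d (T : nmodType) (f : nat -> T) :
  \sum_(a < d.+1) f (d - a)%N = \sum_(a < d.+1) f a.
Proof. by rewrite [RHS](reindex_inj rev_ord_inj) /=; apply: eq_bigr. Qed.

(** Exchanging the two members and reversing both orders maps a state reached
    after one letter back to a state of the initial kind, so that only one kind
    of step has to be analysed. *)
Lemma td_system_mirror d E F th ts : td_system d E F th ts ->
  td_system d (flip d F) (flip d E) (flip d ts) (flip d th).
Proof.
case=> inj injs orth orths sumE sumF rel rels.
have flip_inj f : distinct_upto d f -> distinct_upto d (flip d f).
  move=> finj i j; rewrite !inE => id jd /finj; rewrite !inE !leq_subr.
  by move=> /(_ isT isT); lia.
have eq_flip i j : (i <= d)%N -> (j <= d)%N -> (d - i == d - j)%N = (i == j).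
  by lia.
split; rewrite /flip.
- exact: flip_inj.
- exact: flip_inj.
- by move=> a b x ad bd; rewrite orths ?leq_subr // eq_flip.
- by move=> a b x ad bd; rewrite orth ?leq_subr // eq_flip.
- by move=> x; rewrite (sum_flip d (fun a => F a x)).
- by move=> x; rewrite (sum_flip d (fun a => E a x)).
- move=> i j q x id jd lt_q.
  rewrite (sum_flip d (fun a => ts a ^+ q *: E (d - i)%N (F a (E (d - j)%N x)))).
  by apply: rels; lia.
- move=> i j q x id jd lt_q.
  rewrite (sum_flip d (fun a => th a ^+ q *: F (d - i)%N (E a (F (d - j)%N x)))).
  by apply: rel; lia.
Qed.

(** The words in word_space alternate between the two families, the letter
    applied first being an E. *)
Definition spread d E U : {vspace vT} := (\sum_(a < d.+1) E a @: U)%VS.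

Fixpoint word_space d E F k U : {vspace vT} :=
  if k is k'.+1 then word_space d F E k' (spread d E U) else U.

(** The spaces N k collect the words of length k, counted from a fixed base
    vector, that are already accounted for; the condition lets them be prolonged
    by a letter of the family due at that length. *)
Definition absorbs d E F N : Prop := forall k a, (a <= d)%N ->
  ((if odd k then F a else E a) @: N k <= N k.+1)%VS.

Lemma spread_flip d E U : spread d (flip d E) U = spread d E U.
Proof.
by rewrite /spread [RHS](reindex_inj rev_ord_inj) /=; apply: eq_bigr.
Qed.

Lemma word_space_flip d E F k U :
  word_space d (flip d E) (flip d F) k U = word_space d E F k U.
Proof. by elim: k E F U => //= k IHk E F U; rewrite IHk spread_flip. Qed.

Lemma spreadS d E U W : (U <= W)%VS -> (spread d E U <= spread d E W)%VS.
Proof.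
move=> UW; apply/subv_sumP => a _; apply: subv_trans (limgS _ UW) _.
exact: sumv_sup (subvv _).
Qed.

Lemma spreadD d E U W : (spread d E (U + W) = spread d E U + spread d E W)%VS.
Proof. by rewrite /spread -big_split; apply: eq_bigr => a _; rewrite limgD. Qed.

Lemma word_spaceS d E F k U W :
  (U <= W)%VS -> (word_space d E F k U <= word_space d E F k W)%VS.
Proof. by elim: k E F U W => //= k IHk E F U W UW; apply/IHk/spreadS. Qed.

Lemma word_spaceD d E F k U W :
  (word_space d E F k (U + W) = word_space d E F k U + word_space d E F k W)%VS.
Proof. by elim: k E F U W => //= k IHk E F U W; rewrite spreadD IHk. Qed.

Lemma word_space0 d E F k : word_space d E F k 0 = 0%VS.
Proof.
elim: k E F => //= k IHk E F; rewrite /spread big1 ?IHk // => a _.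
exact: limg0.
Qed.

Lemma word_space_rec d E F k U :
  word_space d E F k.+1 U =
    spread d (if odd k then F else E) (word_space d E F k U).
Proof.
elim: k E F U => // k IHk E F U.
rewrite -[LHS]/(word_space d F E k.+1 (spread d E U)) IHk /=.
by case: (odd k).
Qed.

Lemma absorbs_word d E F N k :
  absorbs d E F N -> (word_space d E F k (N 0%N) <= N k)%VS.
Proof.
move=> NE; elim: k => [|k IHk]; first exact: subvv.
rewrite word_space_rec; apply: subv_trans (spreadS _ _ IHk) _.
apply/subv_sumP => a _; have := NE k a; rewrite -ltnS ltn_ord => /(_ isT).
by case: (odd k).
Qed.

Lemma absorbs_shift d E F N :
  absorbs d E F N -> absorbs d F E (fun k => N k.+1).
Proof. by move=> NE k a ad; have := NE k.+1 a ad; rewrite /=; case: (odd k). Qed.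

Lemma absorbs_word_space d E F U :
  absorbs d E F (fun k => word_space d E F k U).
Proof.
move=> k a ad; rewrite word_space_rec /spread.
have a_lt : (a < d.+1)%N by [].
by case: (odd k); exact: (sumv_sup (Ordinal a_lt)) (subvv _).
Qed.

Lemma absorbsD d E F N1 N2 : absorbs d E F N1 -> absorbs d E F N2 ->
  absorbs d E F (fun k => N1 k + N2 k)%VS.
Proof.
by move=> N1E N2E k a ad; rewrite limgD addvS // ?N1E ?N2E.
Qed.

Lemma absorbs_flip d E F N : absorbs d E F N -> absorbs d (flip d E) (flip d F) N.
Proof. by move=> NE k a ad; apply: NE; apply: leq_subr. Qed.

Lemma absorbs_mem d E F N k a x : absorbs d E F N -> (a <= d)%N ->
  x \in N k -> (if odd k then F a else E a) x \in N k.+1.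
Proof. by move=> NE ad xN; apply: subvP (NE k a ad) _ (memv_img _ xN). Qed.

(** The vector u is the value of a spiral word ending at F_b, and the letters
    that shrink it strictly are the E_a with a in the interval b, ..., b + m - 1.
    The last two fields say that leaving the interval, at once or after one more
    letter, gives nothing new modulo N. *)
Record spiral_state d E F N b m (u : vT) : Prop := SpiralState {
  spiral_bound : (b <= d)%N && (b + m <= d.+1)%N;
  spiral_base : F b u = u;
  spiral_one : forall a, (a <= d)%N -> ~~ (b <= a < b + m)%N -> E a u \in N 1%N;
  spiral_two : forall a j, (a <= d)%N -> (j <= b)%N -> F j (E a u) \in N 2%N
}.

(** Next letters are tried from the far end of the interval inwards; when it is
    the turn of E_(b + t), the vectors E_(b + s) u with s > t are done with, and
    all their prolongations may be added to N. *)
Definition wider E b t m (u : vT) : {vspace vT} :=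
  (\sum_(t.+1 <= s < m) <[E (b + s)%N u]>)%VS.

Definition next_chain d E F N b t m u k : {vspace vT} :=
  (N k.+1 + word_space d F E k (wider E b t m u))%VS.

(** The vectors F_j (E_a u) with a in [b, b + t] and j in ]b, b + t] are the only
    ones not already known modulo the new chain.  For c >= b + t, the array of
    the E_c (F_j (E_a u)) has, by the relations between idempotents, j - b
    vanishing moments in column j and c - a in row a: it is a staircase with
    e = 1, hence zero.  This confines the next letters to the smaller
    interval. *)
Lemma spiral_step d E F th ts N b m t u :
    td_system d E F th ts -> absorbs d E F N ->
    spiral_state d E F N b m u -> (t < m)%N ->
  spiral_state d (flip d F) (flip d E) (next_chain d E F N b t m u)
    (d - (b + t)) t (E (b + t) u).
Proof.
move=> td NE [/andP[bd bmd] ub one two] tm.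
have atd : (b + t <= d)%N by lia.
have NM k x : x \in N k.+1 -> x \in next_chain d E F N b t m u k.
  by move=> xN; apply: (subvP (addvSl _ _)).
have wM a : (b + t < a < b + m)%N -> E a u \in wider E b t m u.
  move=> a_in; have ab_in : (a - b)%N \in index_iota t.+1 m.
    by rewrite mem_index_iota; lia.
  have a_eq : (b + (a - b) = a)%N by lia.
  rewrite /wider (bigD1_seq (a - b)%N) ?iota_uniq //= a_eq.
  by rewrite (subvP (addvSl _ _)) // memv_line.
have ME := absorbsD (absorbs_shift NE) (@absorbs_word_space d F E (wider E b t m u)).
have wM1 a j : (b + t < a < b + m)%N -> (j <= d)%N ->
    F j (E a u) \in next_chain d E F N b t m u 1.
  move=> a_in jd; apply: (absorbs_mem (k := 0) ME jd).
  by rewrite (subvP (addvSr _ _)) // wM.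
have out1 a j : (a <= d)%N -> (j <= d)%N -> ~~ (b <= a <= b + t)%N ->
    F j (E a u) \in next_chain d E F N b t m u 1.
  move=> ad jd a_out; have [a_in | a_in] := boolP (b + t < a < b + m)%N.
    exact: wM1.
  apply: NM; apply: (absorbs_mem (k := 1) NE jd).
  by apply: one => //; move: a_out a_in; lia.
have col q a j : (a <= d)%N -> (j <= d)%N -> (q < j - b)%N ->
    \sum_(s < d.+1) th s ^+ q *: F j (E s u) = 0.
  by move=> ad jd qj; rewrite -[in LHS]ub (td_rel td) //; lia.
(* Column j > b + t has j - b moments and at most t + 1 unknowns. *)
have far a j : (a <= d)%N -> (j <= d)%N -> (b + t < j)%N ->
    F j (E a u) \in next_chain d E F N b t m u 1.
  move=> ad jd tj; move: a ad.
  apply: (@moment_elim _ _ d th (fun a => F j (E a u)) _ b (b + t).+1 (j - b));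
    rewrite ?(td_inj td) //; try lia.
  - exact: (td_inj td).
  - by move=> a ad a_out; apply: out1 => //; move: a_out; lia.
  - by move=> q qj; rewrite (col q b) ?mem0v.
have nonint a j : (a <= d)%N -> (j <= d)%N ->
    ~~ ((b <= a <= b + t) && (b < j <= b + t))%N ->
    F j (E a u) \in next_chain d E F N b t m u 1.
  move=> ad jd; have [a_in /= j_out | a_out _] := boolP (b <= a <= b + t)%N.
    have [jt | jt] := leqP j (b + t); last exact: far.
    by apply: NM; apply: two => //; move: j_out; lia.
  exact: out1.
split.
- by lia.
- by rewrite /flip subKn // (td_orth td) // eqxx.
- by move=> j jd j_out; rewrite /flip; apply: nonint; lia.
move=> j c' jd c_le; rewrite /flip.
have tc : (b + t <= d - c')%N by lia.
have cd : (d - c' <= d)%N by apply: leq_subr.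
move: (d - c')%N tc cd => {c' c_le} c tc cd.
apply: (@staircase_elim _ _ d th ts (fun a j => E c (F j (E a u))) _
          b b.+1 t 1); rewrite ?leq_subr //; try lia.
- exact: (td_inj td).
- exact: (td_injs td).
- move=> a i ad id ai_out; apply: (absorbs_mem (k := 1) ME) => //.
  by apply: nonint => //; move: ai_out; lia.
- by move=> s q st qs; rewrite (td_rels td) ?mem0v //; lia.
- move=> i q it qi; under eq_bigr do rewrite -linearZ.
  by rewrite -linear_sum (col q b) ?linear0 ?mem0v //; lia.
Qed.

(** Strong induction on the width: each first letter E_(b + t) leads to a state
    of width t for the mirrored system, whose spiral words span the rest.  The
    spaces S are sums of the lines spanned by spiral words, whence the bound on
    their components. *)
Lemma spiral_span d m E F th ts N b u :
    td_system d E F th ts -> absorbs d E F N -> spiral_state d E F N b m u ->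
  exists S : bool -> {vspace vT},
    (forall k, (word_space d E F k <[u]> <= N k + S (odd k))%VS) /\
    (forall o i, (i <= d)%N ->
       (\dim ((if o then E else F) i @: S o) <=
          if b <= i then spiral_count o m (i - b) else 0)%N).
Proof.
elim/ltn_ind: m E F th ts N b u => m IHm E F th ts N b u td NE st.
have /fin_all_exists [S S_P] (t : 'I_m) : exists S : bool -> {vspace vT},
    (forall k, (word_space d F E k <[E (b + t)%N u]> <=
                  next_chain d E F N b t m u k + S (odd k))%VS) /\
    (forall o i, (i <= d)%N ->
       (\dim ((if o then F else E) i @: S o) <=
          if i <= b + t then spiral_count o t (b + t - i) else 0)%N).
  have ME := absorbsD (absorbs_shift NE) (@absorbs_word_space d F E (wider E b t m u)).
  have [S [S_span S_dim]] := IHm _ (ltn_ord t) _ _ _ _ _ _ _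
    (td_system_mirror td) (absorbs_flip ME) (spiral_step td NE st (ltn_ord t)).
  exists S; split => [k | o i id]; first by rewrite -word_space_flip.
  have := S_dim o (d - i)%N (leq_subr _ _).
  have b_le : (b + t <= d)%N by case: st => /andP[]; have := ltn_ord t; lia.
  have -> : (d - (b + t) <= d - i)%N = (i <= b + t)%N by lia.
  have -> : (d - i - (d - (b + t)) = b + t - i)%N by lia.
  by case: o; rewrite /flip subKn.
exists (fun o => (if o then 0 else <[u]>) + \sum_(t < m) S t (~~ o))%VS.
case: (st) => /andP[bd bmd] ub one _; split=> [k | o i id].
  case: k => [|k]; first by rewrite (subv_trans _ (addvSr _ _)) // addvSl.
  pose R := (N k.+1 + \sum_(t < m) S t (odd k))%VS.
  (* The letters are inserted from the farthest to the nearest, because the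
     chain for one of them contains the words of all farther ones. *)
  have widerR t : (t <= m)%N ->
      (word_space d F E k (\sum_(m - t <= s < m) <[E (b + s)%N u]>) <= R)%VS.
    elim: t => [_|t IHt tm].
      by rewrite subn0 big_geq // word_space0 sub0v.
    have lt_m : (m - t.+1 < m)%N by lia.
    have eq_m : (m - t.+1).+1 = (m - t)%N by lia.
    rewrite big_ltn // word_spaceD subv_add eq_m IHt ?andbT; last by lia.
    have [S_span _] := S_P (Ordinal lt_m).
    apply: subv_trans (S_span k) _; rewrite /next_chain /= subv_add subv_add.
    rewrite addvSl /wider eq_m IHt ?(ltnW tm) //=.
    by apply: subv_trans (addvSr _ _); apply: (sumv_sup (Ordinal lt_m)).
  have spreadR : (spread d E <[u]> <= N 1%N + \sum_(0 <= s < m) <[E (b + s)%N u]>)%VS.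
    apply/subv_sumP => a _; rewrite limg_line -memvE.
    have [a_in | a_out] := boolP (b <= a < b + m)%N; last first.
      by rewrite (subvP (addvSl _ _)) // one // -ltnS.
    rewrite (subvP (addvSr _ _)) //.
    have ab_in : (a - b)%N \in index_iota 0 m by rewrite mem_index_iota; lia.
    have a_eq : (b + (a - b) = a)%N by lia.
    rewrite (bigD1_seq (a - b)%N) ?iota_uniq //= a_eq.
    by rewrite (subvP (addvSl _ _)) // memv_line.
  rewrite /=; apply: subv_trans (word_spaceS _ _ _ _ spreadR) _.
  rewrite word_spaceD subv_add; apply/andP; split.
    exact: subv_trans (absorbs_word k (absorbs_shift NE)) (addvSl _ _).
  have := widerR m (leqnn m); rewrite subnn => /subv_trans; apply.
  by rewrite negbK addvS // addvSr.
rewrite limgD limg_sum spiral_count_rec; apply: leq_trans (dimv_add_leqif _ _) _.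
have base_dim : (\dim ((if o then E else F) i @: (if o then 0 else <[u]>)%VS) <=
    (b <= i) * (~~ o && (i - b == 0)))%N.
  case: o; first by rewrite limg0 dimv0.
  rewrite limg_line -[in leqLHS]ub (td_orths td) //.
  have [-> | i_ne] := eqVneq i b; last by rewrite dim_vline eqxx.
  by rewrite leqnn subnn eqxx dim_vline leq_b1.
apply: leq_trans (leq_add base_dim (dimv_leq_sum _ _ _)) _.
have step_dim t : (\dim ((if o then E else F) i @: S t (~~ o)) <=
    if i <= b + t then spiral_count (~~ o) t (b + t - i) else 0)%N.
  by have [_ /(_ (~~ o) i id)] := S_P t; rewrite if_neg.
have [bi | ib] := leqP b i.
  rewrite mul1n leq_add2l leq_sum // => t _.
  apply: leq_trans (step_dim t) _; rewrite leq_subLR.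
  by case: ifP => // it; have -> : (b + t - i = t - (i - b))%N by lia.
rewrite add0n big1 // => t _; apply/eqP; rewrite -leqn0.
apply: leq_trans (step_dim t) _; case: ifP => // it.
have t_lt : (t < b + t - i)%N by lia.
case: (nat_of_ord t) t_lt => [|t'] t_lt /=; last by rewrite bin_small //; lia.
by rewrite andbC; case: (_ - _)%N t_lt.
Qed.

Lemma scale_sum_lfun n (f : 'End(vT)) (k : 'I_n -> K) (y : 'I_n -> vT) :
  \sum_a k a *: f (y a) = f (\sum_a k a *: y a).
Proof. by rewrite linear_sum; apply: eq_bigr => a _; rewrite linearZ. Qed.

(** The corner elements F_0 E_a F_0 commute.  The difference D a j b between
    F_0 E_a F_j E_b F_0 and its reversal satisfies the same moment relations as
    its two terms, and it vanishes for a = b.  By descending induction on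
    c = max(a, b), the array D _ _ c has unknown entries only in rows a < c,
    where it is a staircase with e = 0. *)
Lemma commuting_corner d E F th ts x a b :
    td_system d E F th ts -> (a <= d)%N -> (b <= d)%N ->
  F 0%N (E a (F 0%N (E b (F 0%N x)))) = F 0%N (E b (F 0%N (E a (F 0%N x)))).
Proof.
move=> td.
pose D a j b := F 0%N (E a (F j (E b (F 0%N x)))) - F 0%N (E b (F j (E a (F 0%N x)))).
have D_anti i j k : D i j k = - D k j i by rewrite /D opprB.
suff D0 m : (m <= d.+1)%N -> forall i j k, (i <= d)%N -> (j <= d)%N -> (k <= d)%N ->
    (d.+1 - m <= maxn i k)%N -> D i j k = 0.
  by move=> ad bd; apply/subr0_eq/(D0 d.+1) => //; rewrite subnn.
elim: m => [|m IHm] md; first by move=> i j k id jd kd; lia.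
pose c := (d.+1 - m.+1)%N; have old := IHm (ltnW md).
have lastc i j : (i <= d)%N -> (j <= d)%N -> D i j c = 0.
  move=> id jd; apply/eqP; rewrite -memv0.
  have col t q : (t <= d)%N -> (q < t)%N ->
      \sum_(s < d.+1) th s ^+ q *: D s t c \in (0 : {vspace vT})%VS.
    move=> tdd qt; under eq_bigr do rewrite scalerBr.
    rewrite big_split /= sumrN (td_rel td) //; last by lia.
    by rewrite 2!scale_sum_lfun (td_rel td) ?(linear0, subr0, mem0v) //; lia.
  have row s q : (s <= d)%N -> (q < c - s)%N ->
      \sum_(t < d.+1) ts t ^+ q *: D s t c \in (0 : {vspace vT})%VS.
    move=> sd qs; under eq_bigr do rewrite scalerBr.
    rewrite big_split /= sumrN !(scale_sum_lfun (F 0%N)).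
    have cd : (c <= d)%N by rewrite /c; lia.
    by rewrite !(td_rels td) ?(linear0, subr0, mem0v) //; lia.
  have outer s t : (s <= d)%N -> (t <= d)%N -> (c <= s)%N -> D s t c = 0.
    move=> sd tdd; rewrite leq_eqVlt => /predU1P[<- | cs]; first by rewrite /D subrr.
    by apply: old => //; rewrite /c in cs *; lia.
  have far s t : (s <= d)%N -> (t <= d)%N -> (c <= t)%N ->
      D s t c \in (0 : {vspace vT})%VS.
    move=> sd tdd ct; move: s sd.
    apply: (@moment_elim _ _ d th (fun s => D s t c) _ 0 c t) => //; try lia.
    - exact: (td_inj td).
    - by move=> s sd sc; rewrite outer ?mem0v //; lia.
    - by move=> q; apply: col.
  move: i j id jd; apply: (@staircase_elim _ _ d th ts (fun s t => D s t c) _ 0 0 c 0);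
    rewrite ?leq_subr //; try lia.
  - exact: (td_inj td).
  - exact: (td_injs td).
  - move=> s t sd tdd st; have [cs | cs] := leqP c s.
      by rewrite outer ?mem0v //; lia.
    by apply: far => //; lia.
  - by move=> s q sc qs; rewrite add0n; apply: row => //; rewrite /c in sc; lia.
  - by move=> t q tc qt; rewrite add0n; apply: col => //; rewrite /c in tc; lia.
move=> i j k id jd kd; rewrite leq_max -/c => /orP.
have [-> | i_ne] := eqVneq i c; first by rewrite D_anti lastc ?oppr0.
have [-> _ | k_ne ik] := eqVneq k c; first exact: lastc.
by apply: old => //; rewrite /c in i_ne k_ne ik; lia.
Qed.

(** If the corner acts on v by scalars, then v is in a spiral state whose
    interval contains all indices, relative to the chain of all shorter words.
    A word of even length then reduces to spiral words and to a word shorter by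
    two letters, so the spiral words of even length span all words of even
    length.  The latter form a submodule, which is everything by
    irreducibility. *)
Lemma spiral_dim d E F th ts v i :
    td_system d E F th ts -> F 0%N v = v -> v != 0 ->
    (forall a, (a <= d)%N -> F 0%N (E a v) \in <[v]>%VS) ->
    (forall W, (forall a, (a <= d)%N -> (E a @: W <= W)%VS /\ (F a @: W <= W)%VS) ->
       W = 0%VS \/ W = fullv) ->
  (i <= d)%N -> (\dim (F i @: fullv) <= 'C(d, i))%N.
Proof.
move=> td Fv v_neq0 corner irr id.
pose N k := if k is k'.+2 then word_space d E F k' <[v]> else 0%VS.
have NE : absorbs d E F N.
  case=> [|[|k]] a ad /=; try by rewrite limg0 sub0v.
  by have := @absorbs_word_space d E F <[v]> k a ad; rewrite negbK.
have st : spiral_state d E F N 0 d.+1 v.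
  split=> //; first by lia.
    by move=> a ad; rewrite add0n ltnS ad.
  by move=> a j ad; rewrite leqn0 => /eqP ->; apply: corner.
have [S [S_span S_dim]] := spiral_span td NE st.
pose X k := word_space d E F k.*2 <[v]>%VS.
have XS k : (X k <= S false)%VS.
  elim: k => [|k IHk]; first by have := S_span 0%N; rewrite add0v.
  apply: subv_trans (S_span _) _; rewrite odd_double subv_add subvv andbT.
  exact: IHk.
have XSucc k : X k.+1 = spread d F (spread d E (X k)).
  by rewrite /X doubleS !word_space_rec /= odd_double.
have sub_spread E' U :
    (forall x, \sum_(a < d.+1) E' a x = x) -> (U <= spread d E' U)%VS.
  move=> sumE'; apply/subvP => x xU; rewrite -(sumE' x).
  by apply: memv_sumr => a _; apply: memv_img.
have X_incr k : (X k <= X k.+1)%VS.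
  rewrite XSucc; apply: subv_trans (sub_spread E _ (td_sum td)) _.
  exact: sub_spread (td_sums td).
have [k Xk] : exists k, X k.+1 = X k.
  (* A strictly increasing chain of subspaces outgrows the dimension. *)
  have grow k : (exists j, X j.+1 = X j) \/ (k <= \dim (X k))%N.
    elim: k => [|k [|IHk]]; [by right | by left |].
    have [|X_ne] := eqVneq (X k.+1) (X k); first by left; exists k.
    right; apply: leq_ltn_trans IHk _; rewrite ltn_neqAle dimvS // andbT.
    apply: contra X_ne => X_eq.
    by rewrite eq_sym -(geq_leqif (dimv_leqif_eq (X_incr k))) (eqP X_eq).
  have [//|] := grow (\dim {:vT}).+1.
  by rewrite leqNgt ltnS dimvS ?subvf.
have Xfull : X k = fullv.
  have [a ad | X0 | //] := irr (X k); last first.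
    case/eqP: v_neq0; apply/eqP; rewrite -memv0 -X0.
    have X_ge j : (<[v]> <= X j)%VS.
      by elim: j => [|j IHj]; [exact: subvv | exact: subv_trans IHj (X_incr j)].
    exact: X_ge.
  have a_lt : (a < d.+1)%N by [].
  split.
    rewrite -[in X in (_ <= X)%VS]Xk XSucc.
    apply: subv_trans (sub_spread F _ (td_sums td)); rewrite /spread.
    exact: (sumv_sup (Ordinal a_lt)) (subvv _).
  rewrite -Xk XSucc; apply/subvP => _ /memv_imgP[x /memv_sumP[y yF ->] ->].
  rewrite linear_sum /=; apply: memv_sumr => j _.
  have /memv_imgP[z zU ->] := yF j isT.
  rewrite (td_orths td) -1?ltnS //; case: ifP => _; last exact: mem0v.
  exact: memv_img.
rewrite -Xfull; apply: leq_trans (dimvS (limgS _ (XS k))) _.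
by have := S_dim false i id; rewrite subn0.
Qed.

End Words.

(** * Common eigenvectors of commuting operators *)
Lemma exists_eigenvector (C : closedFieldType) (wT : vectType C) (h : 'End(wT)) X :
  X != 0%VS -> (h @: X <= X)%VS ->
  exists l, exists2 v, v != 0 & (v \in X) && (h v == l *: v).
Proof.
move=> X_neq0 hX; set n := \dim X; pose e := vbasis X.
pose M : 'M[C]_n := \matrix_(i, j) coord e j (h e`_i).
have [l] : exists l, root (char_poly M) l.
  apply/closed_rootP; rewrite size_char_poly; by rewrite eqSS dimv_eq0.
rewrite -eigenvalue_root_char => /eigenvalueP[r rM r_neq0].
exists l; exists (\sum_i r 0 i *: e`_i).
  apply: contra r_neq0 => /eqP sum0; apply/eqP/rowP => i; rewrite mxE.
  by have /freeP/(_ (fun i => r 0 i) sum0) := basis_free (vbasisP X); apply.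
have eX (i : 'I_n) : e`_i \in X by rewrite vbasis_mem // mem_nth ?size_tuple.
apply/andP; split; first by apply: memv_suml => i _; rewrite memvZ.
rewrite linear_sum scaler_sumr; apply/eqP.
transitivity (\sum_j (r *m M) 0 j *: e`_j); last first.
  by rewrite rM; apply: eq_bigr => j _; rewrite mxE scalerA.
under [RHS]eq_bigr do rewrite mxE scaler_suml.
rewrite exchange_big /=; apply: eq_bigr => i _.
rewrite linearZ /= [in LHS](coord_vbasis (subvP hX _ (memv_img _ (eX i)))) scaler_sumr.
by apply: eq_bigr => j _; rewrite mxE scalerA.
Qed.

Lemma exists_common_eigenvector (C : closedFieldType) (wT : vectType C)
    (hs : seq 'End(wT)) X :
    X != 0%VS -> {in hs, forall h : 'End(wT), (h @: X <= X)%VS} ->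
    {in hs &, forall (g h : 'End(wT)) x, g (h x) = h (g x)} ->
  exists2 v, v != 0 & (v \in X) && all (fun h : 'End(wT) => h v \in <[v]>%VS) hs.
Proof.
elim: hs X => [|h hs IHhs] X X_neq0 hsX comm.
  by exists (vpick X); rewrite ?vpick0 ?memv_pick.
have [|l [w w_neq0 /andP[wX /eqP hw]]] := exists_eigenvector X_neq0 (h := h).
  by apply: hsX; apply: mem_head.
pose Y := (X :&: lker (h - l *: \1%VF))%VS.
have Yw : w \in Y.
  by rewrite memv_cap wX memv_ker lfun_simp /= hw !lfun_simp subrr.
have [|g ghs|g g' g_in g'_in|v v_neq0 /andP[vY v_all]] := IHhs Y.
- by apply: contra w_neq0 => /eqP Y0; rewrite -memv0 -Y0.
- apply/subvP => _ /memv_imgP[y /[!memv_cap]/andP[yX yh] ->].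
  have gin : g \in h :: hs by rewrite inE ghs orbT.
  rewrite (subvP (hsX _ gin)) ?memv_img //=.
  move: yh; rewrite !memv_ker !lfun_simp !subr_eq0 => /eqP yh.
  by rewrite comm ?mem_head // yh linearZ.
- by apply: comm; rewrite inE ?g_in ?g'_in orbT.
exists v => //; move: vY; rewrite memv_cap memv_ker !lfun_simp subr_eq0.
by case/andP=> -> /eqP hv /=; rewrite v_all hv memvZ ?memv_line.
Qed.

(** * From tridiagonal pairs to systems of idempotents *)
Section Spectral.

Variables (K : fieldType) (vT : vectType K).
Implicit Types (A B : 'End(vT)) (E F : nat -> 'End(vT)) (th ts : nat -> K).
Implicit Types (Vs : seq {vspace vT}).

Record spectral d A E th : Prop := Spectral {
  sp_inj : distinct_upto d th;
  sp_orth : forall a b x, (a <= d)%N -> (b <= d)%N ->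
    E a (E b x) = if a == b then E b x else 0;
  sp_sum : forall x, \sum_(a < d.+1) E a x = x;
  sp_eig : forall a x, (a <= d)%N -> A (E a x) = th a *: E a x;
  sp_neq0 : forall a, (a <= d)%N -> exists x, E a x != 0
}.

(** The tridiagonal condition, read on the idempotents: B moves an eigenspace
    only into itself and its two neighbours. *)
Definition banded d B E : Prop := forall b c x, (b <= d)%N -> (c <= d)%N ->
  (1 < (b - c) + (c - b))%N -> E c (B (E b x)) = 0.

Lemma iter_spectral d A E th n x : spectral d A E th ->
  iter n A x = \sum_(a < d.+1) th a ^+ n *: E a x.
Proof.
move=> sp; elim: n => [|n IHn] /=.
  by rewrite -[LHS](sp_sum sp); apply: eq_bigr => a _; rewrite expr0 scale1r.
rewrite IHn linear_sum; apply: eq_bigr => a _.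
by rewrite linearZ /= (sp_eig sp) -1?ltnS // scalerA exprSr.
Qed.

Lemma spectral_comm d A E th a x : spectral d A E th -> (a <= d)%N ->
  E a (A x) = th a *: E a x.
Proof.
move=> sp ad; rewrite -[in LHS](sp_sum sp x) !linear_sum /=.
have a_lt : (a < d.+1)%N by [].
rewrite (bigD1 (Ordinal a_lt)) //= big1 => [|b b_ne].
  by rewrite addr0 (sp_eig sp) // linearZ /= (sp_orth sp) // eqxx.
rewrite (sp_eig sp) -1?ltnS // linearZ /= (sp_orth sp) -1?ltnS //.
by rewrite eq_sym -[_ == a]/(b == Ordinal a_lt) (negPf b_ne) scaler0.
Qed.

Lemma iter_banded d A E th B n b c x :
    spectral d A E th -> banded d B E -> (b <= d)%N -> (c <= d)%N ->
  (n < (b - c) + (c - b))%N -> E c (iter n B (E b x)) = 0.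
Proof.
move=> sp band bd; elim: n c => [|n IHn] c cd nbc.
  by rewrite /= (sp_orth sp) // ifF //; lia.
rewrite /= -[iter n B _](sp_sum sp) !linear_sum big1 //= => e _.
have ed : (e <= d)%N by rewrite -ltnS.
have [far | near] := ltnP n ((b - e) + (e - b)).
  by rewrite IHn // !linear0.
by rewrite band //; lia.
Qed.

Lemma spectral_td_system d A B E F th ts :
    spectral d A E th -> spectral d B F ts -> banded d B E -> banded d A F ->
  td_system d E F th ts.
Proof.
move=> spA spB bandE bandF; split.
- exact: (sp_inj spA).
- exact: (sp_inj spB).
- exact: (sp_orth spA).
- exact: (sp_orth spB).
- exact: (sp_sum spA).
- exact: (sp_sum spB).
- move=> i j q x id jd qij; rewrite scale_sum_lfun -(iter_spectral _ _ spA).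
  by apply: (iter_banded _ spB) => //; lia.
- move=> i j q x id jd qij; rewrite scale_sum_lfun -(iter_spectral _ _ spB).
  by apply: (iter_banded _ spA) => //; lia.
Qed.

Lemma banded_flag d A F th B i j x :
    spectral d A F th -> banded d B F -> (j <= d)%N -> (i.+1 < j)%N ->
    (forall k, (k <= d)%N -> (i < k)%N -> F k x = 0) ->
  F j (B x) = 0.
Proof.
move=> sp band jd ij Fx; rewrite -[x](sp_sum sp) !linear_sum big1 //= => k _.
have kd : (k <= d)%N by rewrite -ltnS.
have [ik | ki] := ltnP i k; first by rewrite Fx // !linear0.
by rewrite band //; lia.
Qed.

(** If e < d, the sum X over i <= e of the intersections of
    V*_0 + ... + V*_i with V_0 + ... + V_(e - i) is stable: A - th_(e - i)
    maps the i-th term into the next one, B - ts_i into the previous one.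
    It contains V_0 and misses V_d, which contradicts irreducibility.  Both
    flags are written as common kernels of the idempotents beyond them. *)
Lemma diameter_le d e A B E F th ts :
    spectral d A E th -> spectral e B F ts -> banded d B E -> banded e A F ->
    (forall W, (A @: W <= W)%VS -> (B @: W <= W)%VS -> W = 0%VS \/ W = fullv) ->
  (d <= e)%N.
Proof.
move=> spA spB bandE bandF irr; rewrite leqNgt; apply/negP => ed.
pose U i : {vspace vT} := ((\bigcap_(j < e.+1 | (i < j)%N) lker (F j)) :&:
  \bigcap_(a < d.+1 | (e - i < a)%N) lker (E a))%VS.
have UP i x : reflect ((forall j, (j <= e)%N -> (i < j)%N -> F j x = 0) /\
    (forall a, (a <= d)%N -> (e - i < a)%N -> E a x = 0)) (x \in U i).
  apply: (iffP idP) => [|[Fx Ex]].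
    rewrite memv_cap !memvE => /andP[/subv_bigcapP Fx /subv_bigcapP Ex]; split.
      move=> j je ij; have j_lt : (j < e.+1)%N by [].
      by apply/eqP; rewrite -memv_ker memvE (Fx (Ordinal j_lt)).
    move=> a ad ia; have a_lt : (a < d.+1)%N by [].
    by apply/eqP; rewrite -memv_ker memvE (Ex (Ordinal a_lt)).
  rewrite memv_cap !memvE; apply/andP; split.
    by apply/subv_bigcapP => j ij; rewrite -memvE memv_ker Fx // -ltnS.
  by apply/subv_bigcapP => a ia; rewrite -memvE memv_ker Ex // -ltnS.
pose X : {vspace vT} := (\sum_(i < e.+1) U i)%VS.
have memX i x : (i <= e)%N -> x \in U i -> x \in X.
  rewrite -ltnS => ie xU; apply: (subvP _ x xU).
  exact: (sumv_sup (Ordinal ie)) (subvv _).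
have stable (C : 'End(vT)) :
    (forall i x, (i <= e)%N -> x \in U i -> exists c, C x - c *: x \in X) ->
    (C @: X <= X)%VS.
  move=> CU; apply/subvP => _ /memv_imgP[x /memv_sumP[y yU ->] ->].
  rewrite linear_sum /=; apply: memv_suml => i _.
  have ie : (i <= e)%N by rewrite -ltnS.
  have [c Cy] := CU i (y i) ie (yU i isT).
  rewrite -[C _](subrK (c *: y i)); apply: memvD => //.
  by rewrite memvZ // (memX i) // yU.
have AX : (A @: X <= X)%VS.
  apply: stable => i x ie /UP[Fx Ex]; exists (th (e - i)%N).
  have E0 a : (a <= d)%N -> (e - i <= a)%N -> E a (A x - th (e - i)%N *: x) = 0.
    move=> ad; rewrite linearB linearZ /= (spectral_comm _ spA) // -scalerBl.
    rewrite leq_eqVlt => /predU1P[<- | /Ex -> //]; first by rewrite subrr scale0r.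
    by rewrite scaler0.
  have [i_lt | i_ge] := ltnP i e; last first.
    rewrite -[_ - _](sp_sum spA) big1 ?mem0v // => a _.
    by rewrite E0 -1?ltnS //; lia.
  apply: (memX i.+1) => //; apply/UP; split=> [j je ij | a ad ia].
    rewrite linearB linearZ /= (banded_flag spB bandF je ij Fx) Fx //.
      by rewrite scaler0 subrr.
    exact: ltnW.
  by apply: E0 => //; lia.
have BX : (B @: X <= X)%VS.
  apply: stable => i x ie /UP[Fx Ex]; exists (ts i).
  have F0 j : (j <= e)%N -> (i <= j)%N -> F j (B x - ts i *: x) = 0.
    move=> je; rewrite linearB linearZ /= (spectral_comm _ spB) // -scalerBl.
    rewrite leq_eqVlt => /predU1P[<- | /Fx -> //]; first by rewrite subrr scale0r.
    by rewrite scaler0.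
  case: i ie Fx Ex F0 => [|i] ie Fx Ex F0.
    rewrite -[_ - _](sp_sum spB) big1 ?mem0v // => j _.
    by rewrite F0 -1?ltnS.
  apply: (memX i); first by lia.
  apply/UP; split=> [j je ij | a ad ia]; first exact: F0.
  rewrite linearB linearZ /= (banded_flag spA bandE _ _ Ex) //; last by lia.
  by rewrite Ex ?scaler0 ?subrr //; lia.
have [X0 | Xfull] := irr X AX BX.
  have [x] := sp_neq0 spA (leq0n d); rewrite -memv0 -X0 => /negP; apply.
  apply: (memX e) => //; apply/UP; split=> [j je | a ad]; first by lia.
  by rewrite subnn => a_gt0; rewrite (sp_orth spA) // ifF //; lia.
have [x /eqP] := sp_neq0 spA (leqnn d); apply.
have := memvf x; rewrite -Xfull => /memv_sumP[y yU ->].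
rewrite linear_sum big1 //= => i _.
have /UP[_ Ey] := yU i isT.
by apply: Ey => //; lia.
Qed.

Lemma spectral_of_ordering A Vs d :
    diagonalizable_end A -> eigenspace_ordering A Vs -> size Vs = d.+1 ->
  exists E th, spectral d A E th /\
    (forall a, (a <= d)%N -> (E a @: fullv)%VS = nth 0%VS Vs a) /\
    (forall a b x, (a <= d)%N -> (b <= d)%N -> a != b ->
       x \in nth 0%VS Vs b -> E a x = 0).
Proof.
move=> diagA [uniqV memV] szV.
have /fin_all_exists[t tP] (i : 'I_d.+1) : exists l : K,
    nth 0%VS Vs i != 0%VS /\
    forall x, (x \in nth 0%VS Vs i) = (A x == l *: x).
  have /memV[/eqP Vi_neq0 [l Vi]] : nth 0%VS Vs i \in Vs by rewrite mem_nth ?szV.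
  exists l; split=> // x.
  by rewrite Vi memv_ker !lfun_simp subr_eq0.
pose th a := t (inord a).
have thP a x : (a <= d)%N -> (x \in nth 0%VS Vs a) = (A x == th a *: x).
  by move=> ad; have [_ /(_ x)] := tP (inord a); rewrite inordK.
have th_inj : distinct_upto d th.
  move=> a b; rewrite !inE => ad bd eq_th.
  apply/eqP; rewrite -(nth_uniq 0%VS _ _ uniqV) ?szV //.
  by apply/eqP/vspaceP => x; rewrite !thP // eq_th.
(* Lagrange interpolation at the eigenvalues gives the idempotents. *)
pose factor a b : 'End(vT) := (th a - th b)^-1 *: (A - th b *: \1%VF).
pose L a s := foldr (fun b f => factor a b \o f)%VF \1%VF s.
have LE a s l x : A x = l *: x ->
    L a s x = (\prod_(b <- s) ((th a - th b)^-1 * (l - th b))) *: x.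
  move=> Ax; elim: s => [|b s IHs] /=; first by rewrite big_nil id_lfunE scale1r.
  rewrite big_cons comp_lfunE IHs linearZ /= !lfun_simp Ax -scalerBl !scalerA.
  by rewrite -mulrA [X in X *: _]mulrC.
pose E a := L a (rem a (iota 0 d.+1)).
have EV a b x : (a <= d)%N -> (b <= d)%N -> x \in nth 0%VS Vs b ->
    E a x = if a == b then x else 0.
  move=> ad bd; rewrite thP // => /eqP Ax; rewrite /E (LE _ _ _ _ Ax).
  case: eqVneq => [<- | ab].
    rewrite big_seq big1 ?scale1r // => c.
    rewrite mem_rem_uniq ?iota_uniq // inE mem_iota => /andP[/= c_ne c_lt].
    rewrite mulVf // subr_eq0; apply: contra c_ne => /eqP eq_th.
    by apply/eqP; symmetry; apply: th_inj.
  rewrite (big_rem b); last first.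
    by rewrite mem_rem_uniq ?iota_uniq // inE mem_iota eq_sym ab.
  by rewrite /= subrr mulr0 mul0r scale0r.
have span x : exists2 y, (forall i : 'I_d.+1, y i \in nth 0%VS Vs i) & x = \sum_i y i.
  have full : (\sum_(i < d.+1) nth 0%VS Vs i)%VS = fullv.
    apply: diagA => U /memV UV.
    have i_lt : (index U Vs < d.+1)%N by rewrite -szV index_mem.
    by apply: (sumv_sup (Ordinal i_lt)) => //=; rewrite nth_index.
  have := memvf x; rewrite -full => /memv_sumP[y yV ->].
  by exists y => // i; apply: yV.
have ES a (ad : (a < d.+1)%N) (y : 'I_d.+1 -> vT) :
    (forall i : 'I_d.+1, y i \in nth 0%VS Vs i) ->
    E a (\sum_i y i) = y (Ordinal ad).
  move=> yV; rewrite linear_sum (bigD1 (Ordinal ad)) //= big1 => [|i i_ne].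
    by rewrite (EV a a) ?eqxx ?addr0 //; apply: (yV (Ordinal ad)).
  rewrite (EV a i) -1?ltnS //.
  by rewrite eq_sym -[_ == a]/(i == Ordinal ad) (negPf i_ne).
have E_in a x : (a <= d)%N -> E a x \in nth 0%VS Vs a.
  move=> ad; have [y yV ->] := span x.
  by rewrite (ES a ad) //; apply: (yV (Ordinal _)).
exists E, th; split; last first.
  split=> [a ad | a b x ad bd ab xV]; last by rewrite (EV a b) ?(negPf ab).
  apply/eqP; rewrite eqEsubv; apply/andP; split; apply/subvP => x.
    by case/memv_imgP=> z _ ->; apply: E_in.
  by move=> xV; have := EV a a x ad ad xV; rewrite eqxx => <-; rewrite memv_img ?memvf.
split=> //.
- by move=> a b x ad bd; apply: EV => //; apply: E_in.
- move=> x; have [y yV ->] := span x; apply: eq_bigr => a _.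
  by rewrite (ES a (ltn_ord a)) //; congr y; apply: val_inj.
- by move=> a x ad; apply/eqP; rewrite -thP // E_in.
- move=> a ad; have [V_neq0 _] := tP (inord a).
  exists (vpick (nth 0%VS Vs a)); rewrite (EV a a) ?memv_pick // eqxx vpick0.
  by rewrite inordK in V_neq0.
Qed.

Lemma banded_of_standard A B Vs d E :
    standard_ordering A B Vs -> size Vs = d.+1 ->
    (forall a, (a <= d)%N -> (E a @: fullv)%VS = nth 0%VS Vs a) ->
    (forall a b x, (a <= d)%N -> (b <= d)%N -> a != b ->
       x \in nth 0%VS Vs b -> E a x = 0) ->
  banded d B E.
Proof.
move=> [_ tri] szV imE killE b c x bd cd bc.
have : B (E b x) \in (prev_space Vs b + nth 0%VS Vs b + nth 0%VS Vs b.+1)%VS.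
  apply: (subvP (tri b _)); rewrite ?szV // memv_img // -imE //.
  by rewrite memv_img ?memvf.
case/memv_addP=> _ /memv_addP[y y_in [z z_in ->]] [w w_in ->].
rewrite !linearD /= (killE c b z) //; last by lia.
have -> : E c y = 0.
  case: b bd bc y_in {z_in w_in} => [|b] bd bc /=.
    by rewrite memv0 => /eqP->; rewrite linear0.
  by move=> y_in; rewrite (killE c b) //; lia.
have -> : E c w = 0; last by rewrite !addr0.
have [b_lt | b_ge] := ltnP b d; first by rewrite (killE c b.+1) //; lia.
by move: w_in; rewrite nth_default ?szV // memv0 => /eqP->; rewrite linear0.
Qed.

End Spectral.

(** * The bound on the shape *)
Theorem corollary1p4 (K : closedFieldType) (vT : vectType K)
    (dim_gt0 : (0 < \dim {:vT})%N) (A Astar : 'End(vT))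
    (d : nat) (rho : seq nat)
    (tdA : tridiagonal_pair A Astar)
    (diamA : has_diameter A Astar d) (shapeA : has_shape A Astar rho) :
  forall i : nat, (i <= d)%N -> (nth 0%N rho i <= 'C(d, i))%N.
Proof.
move=> i id; case: tdA => [[diagA diagB] _ [Ws stdB] irr0].
have irr W : (A @: W <= W)%VS -> (Astar @: W <= W)%VS -> W = 0%VS \/ W = fullv.
  move=> AW BW; have [-> | /eqP W0] := eqVneq W 0%VS; first by left.
  have [-> | /eqP Wfull] := eqVneq W fullv; first by right.
  by case: irr0; exists W.
case: shapeA => Vs stdA ->; case: diamA => Vs' stdA' szV'.
have szV : size Vs = d.+1.
  case: (stdA) (stdA') => [[uV memV] _] [[uV' memV'] _]; rewrite -szV'.
  apply/perm_size/uniq_perm => // U.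
  by apply/idP/idP => [/memV/memV' | /memV'/memV].
have [F [ts [spA [imF killF]]]] := spectral_of_ordering diagA stdA.1 szV.
have [e szW] : exists e, size Ws = e.+1.
  case: Ws stdB => [[[_ memW] _] | W Ws _]; last by exists (size Ws).
  have zero_full : 0%VS = fullv :> {vspace vT} by apply: diagB => U /memW.
  by rewrite -zero_full dimv0 in dim_gt0.
have [E [th [spB [imE killE]]]] := spectral_of_ordering diagB stdB.1 szW.
have bandF := banded_of_standard stdA szV imF killF.
have bandE := banded_of_standard stdB szW imE killE.
have irr' W BW AW := irr W AW BW.
have ed : e = d.
  apply/eqP; rewrite eqn_leq (diameter_le spB spA bandE bandF irr').
  by rewrite (diameter_le spA spB bandF bandE irr).
subst e.
(* The spiral words end in an F, and the shape is read off the eigenspaces of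
   A: hence the roles of the two members. *)
have td := spectral_td_system spB spA bandE bandF.
pose h a : 'End(vT) := (F 0%N \o E a \o F 0%N)%VF.
have [|g|g g'|v v_neq0] :=
  @exists_common_eigenvector _ _ [seq h a | a <- iota 0 d.+1] (F 0%N @: fullv)%VS.
- have [x Fx] := sp_neq0 spA (leq0n d).
  apply: contra Fx => /eqP X0.
  by rewrite -memv0 -X0 memv_img ?memvf.
- case/mapP=> a _ ->; apply/subvP => _ /memv_imgP[x _ ->].
  by rewrite /h !comp_lfunE memv_img ?memvf.
- case/mapP=> a a_in -> /mapP[b b_in ->] x; rewrite /h !comp_lfunE.
  rewrite !mem_iota /= in a_in b_in.
  by rewrite !(td_orths td) // (commuting_corner x td).
case/andP=> v_in /allP v_eig.
have Fv : F 0%N v = v.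
  by case/memv_imgP: v_in => z _ ->; rewrite (td_orths td).
rewrite (nth_map 0%VS) ?szV // -imF //.
apply: (spiral_dim td Fv v_neq0) => // [a ad | W EFW].
  have := v_eig (h a); rewrite map_f ?mem_iota // => /(_ isT).
  by rewrite /h !comp_lfunE Fv.
apply: irr; apply/subvP => _ /memv_imgP[x xW ->].
  rewrite -[A x]/(iter 1 A x) (iter_spectral 1 x spA); apply: memv_suml => a _.
  have ad : (a <= d)%N by rewrite -ltnS.
  by rewrite memvZ // (subvP (EFW a ad).2) ?memv_img.
rewrite -[Astar x]/(iter 1 Astar x) (iter_spectral 1 x spB); apply: memv_suml => a _.
have ad : (a <= d)%N by rewrite -ltnS.
by rewrite memvZ // (subvP (EFW a ad).1) ?memv_img.
Qed.
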